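(* Let $\mathcal{S}=(s_i)_{i=0}^\infty$ be any binary sequence (i.e. $s_i\in\mathbb{F}_2$ for all $i$) and let $N\ge 1$ be an integer. Then $$M(\mathcal{S},N)\ \ge\ N-2^{M(\mathcal{S},N)+1}\max_{1\le k\le M(\mathcal{S},N)+1} C_k(\mathcal{S},N),$$ where $M(\mathcal{S},N)$ is the $N$th maximum-order complexity and $C_k(\mathcal{S},N)$ the $N$th correlation measure of order $k$ of $\mathcal{S}$, as defined below.
   Context: For a binary sequence $\mathcal{S}=(s_i)_{i=0}^\infty$ over $\mathbb{F}_2$ and a positive integer $N$, the $N$th maximum-order complexity $M(\mathcal{S},N)$ is the smallest positive integer $M$ such that there is a polynomial $f(x_1,\ldots,x_M)\in\mathbb{F}_2[x_1,\ldots,x_M]$ with $s_{i+M}=f(s_i,s_{i+1},\ldots,s_{i+M-1})$ for all $0\le i\le N-M-1$. For a positive integer $k$, the $N$th correlation measure of order $k$ is $$C_k(\mathcal{S},N)=\max_{U,D}\left|\sum_{i=0}^{U-1}(-1)^{s_{i+d_1}+s_{i+d_2}+\cdots+s_{i+d_k}}\right|,$$ where the maximum is taken over all tuples $D=(d_1,\ldots,d_k)$ of integers with $0\le d_1<d_2<\cdots<d_k$ and all positive integers $U$ with $U+d_k\le N$ (here $s_j\in\{0,1\}$ is viewed as an integer in the exponent). *)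

(* Defs.v *)
(* MathComp world, with the multinomials library for multivariate polynomials. *)
From mathcomp Require Import all_boot all_order all_algebra.
From mathcomp Require Import mpoly.
From mathcomp Require boolp.

Set Implicit Arguments.
Unset Strict Implicit.
Unset Printing Implicit Defensive.

Import GRing.Theory Num.Theory.
Local Open Scope ring_scope.

Definition binary_sequence := nat -> 'F_2.

(* The range 0 <= i <= N - M - 1 (untruncated subtraction, hence possibly empty)
   is written i + M < N. *)
Definition poly_recurrence (s : binary_sequence) (N M : nat) : Prop :=
  exists f : {mpoly 'F_2[M]},
    forall i : nat, (i + M < N)%N -> s (i + M)%N = f.@[fun j : 'I_M => s (i + j)%N].

Definition moc_candidate (s : binary_sequence) (N M : nat) : bool :=
  (0 < M)%N && boolp.asbool (poly_recurrence s N M).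

Lemma moc_candidate_ex (s : binary_sequence) (N : nat) :
  exists M, moc_candidate s N M.
Proof.
exists N.+1; apply/andP; split=> //; apply/boolp.asboolP.
by exists 0 => i; rewrite addnS ltnNge leqW ?leq_addl.
Qed.

Definition max_order_complexity (s : binary_sequence) (N : nat) : nat :=
  ex_minn (moc_candidate_ex s N).

(* The coercion to nat sends an element of F_2 to its representative 0 or 1. *)
Definition correlation_sum (s : binary_sequence) (U : nat) (D : seq nat) : int :=
  \sum_(i < U) (-1) ^+ (\sum_(d <- D) (s (i + d) : nat))%N.

(* The constraints 0 < U and U + d_k <= N force U <= N and d_1, ..., d_k < N, so
   the maximum is over a finite index set. That set is empty exactly when k > N
   (for k > 0), and the maximum is then 0. *)
Definition correlation_measure (s : binary_sequence) (k N : nat) : nat :=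
  \max_(U < N.+1 | (0 < U)%N)
    \max_(D : k.-tuple 'I_N | sorted ltn (map val D) &&
                              (U + last 0 (map val D) <= N)%N)
      `|correlation_sum s U (map val D)|%N.

(* Main.v *)
Require Import Defs.
From mathcomp Require Import all_boot all_order all_algebra.
From mathcomp Require Import mpoly boolp zify.

Set Implicit Arguments.
Unset Strict Implicit.
Unset Printing Implicit Defensive.

Import Order.TTheory GRing.Theory Num.Theory.

Local Open Scope ring_scope.

(** Let M be the maximum-order complexity and U = N - M. The recurrence
    s_(i+M) = f(s_i, ..., s_(i+M-1)) forbids the pattern b = (0, ..., 0, f(0) + 1)
    among the U windows (s_i, ..., s_(i+M)), so
    sum_(i < U) prod_(j <= M) (1 + (-1)^(s_(i+j) + b_j)) = 0.
    Expanding the product over subsets J of {0, ..., M}, the empty set contributes U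
    and every other J contributes, up to sign, a correlation sum of order #|J|. *)

Lemma correlation_sum_le (s : binary_sequence) (N U : nat) (D : seq 'I_N) :
  (0 < U)%N -> sorted ltn (map val D) -> (U + last 0 (map val D) <= N)%N ->
  (`|correlation_sum s U (map val D)|%N <= correlation_measure s (size D) N)%N.
Proof.
move=> U_gt0 sortD UD.
have ltUN : (U < N.+1)%N by rewrite ltnS (leq_trans (leq_addr _ _) UD).
rewrite /correlation_measure.
apply: (bigop.bigmax_sup (Ordinal ltUN)) => //=.
apply: (bigop.bigmax_sup (in_tuple D)) => //=.
by rewrite sortD UD.
Qed.

Lemma sorted_enum_ord (n : nat) (A : {set 'I_n}) : sorted ltn (map val (enum A)).
Proof.
apply: (@subseq_sorted _ ltn ltn_trans _ (iota 0 n)); last exact: iota_ltn_sorted.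
by rewrite -val_enum_ord map_subseq // enumT filter_subseq.
Qed.

(** Positions in a window are at most [m], and [0 < U] forces [m < N], so the elements of [J] in
    increasing order are admissible lags. *)
Lemma correlation_sum_subset (s : binary_sequence) (N U m : nat)
    (J : {set 'I_m.+1}) :
  (0 < U)%N -> (U + m <= N)%N ->
  (`|correlation_sum s U (map val (enum J))|%N
     <= correlation_measure s #|J| N)%N.
Proof.
move=> U_gt0 UmN; have ltmN : (m.+1 <= N)%N by lia.
have valE : map val (enum J) = map val (map (widen_ord ltmN) (enum J)).
  by rewrite -map_comp.
rewrite cardE -(size_map (widen_ord ltmN)) valE.
apply: correlation_sum_le => //; rewrite -valE; first exact: sorted_enum_ord.
apply: leq_trans UmN; rewrite leq_add2l.
(* For empty [J] the default 0 of [last] also satisfies the bound. *)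
case: (enum J) => [|x t] //=.
by rewrite last_map -ltnS ltn_ord.
Qed.

Lemma sign_F2_eq0 (x y : 'F_2) :
  x != y -> 1 + (-1) ^+ (y : nat) * (-1) ^+ (x : nat) = 0 :> int.
Proof. by case: x y => [[|[|x]] ?] [[|[|y]] ?]. Qed.

Lemma forbidden_pattern_bound (s : binary_sequence) (N U m : nat)
    (b : 'I_m.+1 -> 'F_2) :
  (U + m <= N)%N ->
  (forall i, (i < U)%N -> exists j : 'I_m.+1, s (i + j)%N != b j) ->
  (U <= 2 ^ m.+1 * \max_(1 <= k < m.+2) correlation_measure s k N)%N.
Proof.
move=> UmN avoid; have [->//|U_gt0] := posnP U.
set C := (\max_(_ <= k < _) _)%N.
pose sg (J : {set 'I_m.+1}) : int := \prod_(j in J) (-1) ^+ (b j : nat).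
pose c (J : {set 'I_m.+1}) := correlation_sum s U (map val (enum J)).
have sum0 : \sum_(J : {set 'I_m.+1}) sg J * c J = 0.
  transitivity (\sum_(i < U) \prod_(j : 'I_m.+1)
      ((-1) ^+ (b j : nat) * (-1) ^+ (s (i + j)%N : nat) + 1) : int); last first.
    (* At a position [j] where the window differs from [b] the two signs are equal or opposite to 1
       in product: the factor is -1 + 1 = 0. *)
    apply: big1 => i _; have [j sNb] := avoid i (ltn_ord i).
    by rewrite (bigD1 j) //= addrC sign_F2_eq0 ?mul0r.
  under [RHS]eq_bigr => i _ do rewrite bigA_distr.
  rewrite exchange_big; apply: eq_bigr => J _ /=.
  rewrite /c /correlation_sum mulr_sumr; apply: eq_bigr => i _.
  (* Positions outside [J] contribute the factor 1, so only the product over [J] remains. *)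
  rewrite -big_mkcond big_split /= big_map big_enum /=; congr (_ * _).
  by rewrite expr_sum.
have sg_norm J : `|sg J| = 1.
  by rewrite normr_prod big1 // => j _; rewrite normrX normrN1 expr1n.
have c0 : sg set0 * c set0 = U%:Z.
  rewrite /sg /c big_set0 enum_set0 mul1r /correlation_sum.
  under eq_bigr do rewrite big_nil expr0.
  by rewrite sumr_const card_ord natz.
have cC J : J != set0 -> `|sg J * c J| <= C%:Z.
  move=> J0; rewrite normrM sg_norm mul1r -abszE lez_nat.
  apply: leq_trans (correlation_sum_subset s J U_gt0 UmN) _.
  rewrite /C (bigmaxn_sup_seq #|J|) ?mem_index_iota //.
  rewrite card_gt0 J0 ltnS /=.
  by rewrite -[X in (_ <= X)%N](card_ord m.+1) max_card.
have {sum0 c0} Ueq : U%:Z = - \sum_(J | J != set0) sg J * c J.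
  by apply/eqP; rewrite -addr_eq0 -c0 -[X in _ == X]sum0 [X in _ == X](bigD1 set0).
rewrite -lez_nat -[U%:Z]ger0_norm // Ueq normrN.
apply: le_trans (ler_norm_sum _ _ _) _.
apply: le_trans (ler_sum _ cC) _.
(* The nonempty subsets are counted crudely by all [2 ^ m.+1] subsets. *)
rewrite sumr_const -mulr_natl natz -PoszM lez_nat leq_mul2r; apply/orP; right.
by rewrite (leq_trans (max_card _)) // -cardsT -powersetT card_powerset cardsT card_ord.
Qed.

(** The first [M] entries of a window determine its last one, so any block of length [M] followed by
    the wrong value never occurs; the zero block is a convenient choice. *)
Lemma poly_recurrence_avoids (s : binary_sequence) (N M : nat) :
  poly_recurrence s N M ->
  exists b : 'I_M.+1 -> 'F_2,
    forall i, (i + M < N)%N -> exists j : 'I_M.+1, s (i + j)%N != b j.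
Proof.
case=> f rec; pose y := f.@[fun=> 0].
exists (fun j => if (j < M)%N then 0 else y + 1) => i iMN.
apply/existsP; apply: contraT; rewrite negb_exists => /forallP sb.
have {}sb (j : 'I_M.+1) : s (i + j)%N = if (j < M)%N then 0 else y + 1.
  by apply/eqP; have := sb j; rewrite negbK.
(* The last entry would be [y + 1] by the pattern and [y] by the recurrence. *)
have := rec i iMN; have /= := sb ord_max; rewrite ltnn => ->.
have -> : (fun j : 'I_M => s (i + j)%N) = fun=> 0.
  apply: funext => j; have /= -> := sb (widen_ord (leqnSn M) j).
  by rewrite ltn_ord.
by move/eqP; rewrite -subr_eq0 addrC addKr oner_eq0.
Qed.

Theorem theorem1 (s : binary_sequence) (N : nat) (hN : (1 <= N)%N) :
  (N%:Z - 2 ^+ (max_order_complexity s N).+1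
            * (\max_(1 <= k < (max_order_complexity s N).+2)
                 correlation_measure s k N)%N%:Z
   <= (max_order_complexity s N)%:Z)%R.
Proof.
have : poly_recurrence s N (max_order_complexity s N).
  by rewrite /max_order_complexity; case: ex_minnP => M /andP[_ /asboolP].
move: (max_order_complexity s N) => M /poly_recurrence_avoids[b avoid].
rewrite lerBlDr -natrX natz -PoszM -PoszD lez_nat -leq_subLR.
(* The goal now bounds the truncated [N - M], which is 0 when [N <= M]. *)
have [NM|MN] := leqP N M; first by rewrite (eqP NM).
apply: (forbidden_pattern_bound (b := b)) => [|i iU]; first by rewrite subnK // ltnW.
by apply: avoid; rewrite addnC -ltn_subRL.
Qed.
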